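(* Let $\kappa>0$ and $\lambda\in\mathbb C\setminus\{0\}$. For every finite interval $\Lambda\subset\mathbb Z$ with $|\Lambda|\ge8$ or $|\Lambda|\in\{5,6\}$, $\ker H_\Lambda=\mathcal G_\Lambda$. For $|\Lambda|=7$, $\ker H_\Lambda=\mathcal G_\Lambda\oplus\operatorname{span}\{|1100011\rangle\}$.
   Context: $\mathcal H_\Lambda=\bigotimes_{x\in\Lambda}\mathbb C^2$ with basis $|1\rangle,|0\rangle$ per site and product basis $|\boldsymbol\sigma\rangle$; $n_x=|1\rangle\langle1|_x$, $\sigma^-_x=|0\rangle\langle1|_x$. For $\Lambda=[a,b]$, $H_\Lambda=\sum_{x=a}^{b-2}n_xn_{x+2}+\kappa\sum_{x=a}^{b-3}q_x^*q_x$ with $q_x=\sigma^-_{x+1}\sigma^-_{x+2}-\lambda\sigma^-_x\sigma^-_{x+3}$. Tiles occupy consecutive sites and carry 0/1 words: void $0$; monomer $100$; dimer $011000$; left boundary dimer $11000$ (only as first tile); and, only as last tile: right dimer $011$, right 1-monomer $1$, right 2-monomer $10$, truncated 1-dimer $0110$, truncated 2-dimer $01100$. A root tiling $R$ of $\Lambda$ is a tiling by consecutive voids and monomers, optionally with a left boundary dimer as first tile and optionally with one of right dimer, right 1-monomer, right 2-monomer as last tile; $\mathcal R_\Lambda$ is their set. A VMD tiling derived from $R$ is obtained by choosing disjoint pairs of consecutive tiles of $R$, each either two monomers (replaced by a dimer) or a monomer followed by a right $j$-monomer, $j\in\{1,2\}$ (replaced by the truncated $j$-dimer); $\mathcal D_\Lambda(R)$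 is their set, $\boldsymbol\sigma_\Lambda(\mathbf D)$ the concatenated content, $\#(\mathbf D)$ the number of tiles that are dimers, boundary dimers or truncated dimers, $\psi_\Lambda(R)=\sum_{\mathbf D\in\mathcal D_\Lambda(R)}\lambda^{\#(\mathbf D)}|\boldsymbol\sigma_\Lambda(\mathbf D)\rangle$ and $\mathcal G_\Lambda=\operatorname{span}\{\psi_\Lambda(R):R\in\mathcal R_\Lambda\}$. *)

(* Defs.v *)
From HB Require Import structures.
From mathcomp Require Import all_boot all_order all_algebra.
Set Implicit Arguments. Unset Strict Implicit. Unset Printing Implicit Defensive.
Import GRing.Theory Num.Theory.
Local Open Scope ring_scope.

(* Conventions: the interval Lambda = [a,b] is relabelled as sites 0..n-1,
   n = |Lambda| (all definitions are translation invariant).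
   A product basis vector |sigma> is an n-tuple of booleans, true = |1>, false = |0>.
   Vectors of H_Lambda are functions cfg n -> C; operators are kernels
   cfg n -> cfg n -> C (matrix elements <tau| A |sigma>). *)

Definition cfg (n : nat) := (n.-tuple bool).
Definition site n (s : cfg n) (x : nat) : bool := nth false s x.

Section Ops.
Variable C : numClosedFieldType.
Variable n : nat.

Definition op := cfg n -> cfg n -> C.

Definition embed1 (x : nat) (A : bool -> bool -> C) : op :=
  fun t s => A (site t x) (site s x) *
    ([forall i : 'I_n, (val i != x) ==> (tnth t i == tnth s i)] : nat)%:R.

Definition comp (A B : op) : op := fun t s => \sum_(r : cfg n) A t r * B r s.
Definition adj (A : op) : op := fun t s => (A s t)^*.

Definition nmat : bool -> bool -> C := fun b b' => ((b && b') : nat)%:R.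
Definition smin : bool -> bool -> C := fun b b' => ((~~ b && b') : nat)%:R.

Definition nn (x : nat) : op := comp (embed1 x nmat) (embed1 (x + 2) nmat).
Definition qop (lam : C) (x : nat) : op := fun t s =>
  comp (embed1 (x + 1) smin) (embed1 (x + 2) smin) t s
  - lam * comp (embed1 x smin) (embed1 (x + 3) smin) t s.

Definition Ham (kappa lam : C) : op := fun t s =>
  \sum_(0 <= x < n - 2) nn x t s
  + kappa * \sum_(0 <= x < n - 3) comp (adj (qop lam x)) (qop lam x) t s.

Definition apply_op (A : op) (psi : {ffun cfg n -> C}) : {ffun cfg n -> C} :=
  [ffun t => \sum_(s : cfg n) A t s * psi s].

Definition in_ker (kappa lam : C) (psi : {ffun cfg n -> C}) : Prop :=
  apply_op (Ham kappa lam) psi = 0.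

Definition vscale (a : C) (f : {ffun cfg n -> C}) : {ffun cfg n -> C} :=
  [ffun t => a * f t].

Definition ket (s : seq bool) : {ffun cfg n -> C} :=
  [ffun t : cfg n => ((val t == s) : nat)%:R].

End Ops.

Inductive tile : Type :=
| Void | Mono | Dimer | LBDimer | RDimer | RMono1 | RMono2 | Trunc1 | Trunc2.

Definition content (t : tile) : seq bool :=
  match t with
  | Void => [:: false]
  | Mono => [:: true; false; false]
  | Dimer => [:: false; true; true; false; false; false]
  | LBDimer => [:: true; true; false; false; false]
  | RDimer => [:: false; true; true]
  | RMono1 => [:: true]
  | RMono2 => [:: true; false]
  | Trunc1 => [:: false; true; true; false]
  | Trunc2 => [:: false; true; true; false; false]
  end.

Definition tiling_content (T : seq tile) : seq bool := flatten (map content T).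

Definition is_void_or_mono (t : tile) : bool :=
  match t with Void | Mono => true | _ => false end.
Definition is_right_last (t : tile) : bool :=
  match t with RDimer | RMono1 | RMono2 => true | _ => false end.
Definition is_dimerlike (t : tile) : bool :=
  match t with Dimer | LBDimer | Trunc1 | Trunc2 => true | _ => false end.

Definition root_tiling (n : nat) (R : seq tile) : Prop :=
  exists pre mid suf,
    R = pre ++ mid ++ suf /\
    (pre = [::] \/ pre = [:: LBDimer]) /\
    all is_void_or_mono mid /\
    (suf = [::] \/ exists t, suf = [:: t] /\ is_right_last t) /\
    size (tiling_content R) = n.

(* all VMD tilings derived from R: choose disjoint pairs of consecutive tiles
   (monomer,monomer) -> dimer, (monomer, right j-monomer) -> truncated j-dimer *)
Fixpoint derive (R : seq tile) : seq (seq tile) :=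
  match R with
  | [::] => [:: [::]]
  | t :: rest =>
    [seq t :: d | d <- derive rest] ++
    match t, rest with
    | Mono, Mono :: rest' => [seq Dimer :: d | d <- derive rest']
    | Mono, RMono1 :: rest' => [seq Trunc1 :: d | d <- derive rest']
    | Mono, RMono2 :: rest' => [seq Trunc2 :: d | d <- derive rest']
    | _, _ => [::]
    end
  end.

Definition psiR (C : numClosedFieldType) (n : nat) (lam : C) (R : seq tile)
  : {ffun cfg n -> C} :=
  \sum_(D <- derive R) vscale (lam ^+ count is_dimerlike D) (ket C n (tiling_content D)).

Definition in_G (C : numClosedFieldType) (n : nat) (lam : C)
  (psi : {ffun cfg n -> C}) : Prop :=
  exists rs : seq (C * seq tile),
    (forall i, (i < size rs)%N -> root_tiling n (nth (0, [::]) rs i).2) /\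
    psi = \sum_(p <- rs) vscale p.1 (psiR n lam p.2).

(* Main.v *)
(* Each term of H is a positive multiple of some A^* A (the n_x n_{x+2} are
   projections), so ker H is the joint kernel of the A.  For the coefficients
   f(s) = <s|psi> of a vector psi this says f(u1b1v) = 0 and
   f(u0110v) = lam f(u1001v).
   Merging a monomer with the next tile turns 1001 into 0110, whichever of the
   three kinds of tile follows.  Hence psi(Void R) = |0> psi(R) and
   psi(Mono R) = |100> psi(R) + lam |0110> <1|psi(R).  Both maps produce ground
   states from ground states f with <11|f = 0.  Conversely, such an f is the image
   of <100|f under the second map plus |0> f' plus four boundary terms, where
   <100|f and f' are ground states of the same kind on shorter words; by induction
   f is a combination of the psi(R).  For n >= 5 a general ground state f differs
   from such a one by |11000> <11000|f, and <1100011|f is the only obstruction to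
   <11000|f being of that kind too. *)
Require Import Defs.
From mathcomp Require Import all_boot all_order all_algebra.
From mathcomp Require Import zify ring.
Import Order.TTheory GRing.Theory Num.Theory.
Local Open Scope ring_scope.
Set Implicit Arguments. Unset Strict Implicit. Unset Printing Implicit Defensive.

Local Notation w0110 := [:: false; true; true; false].
Local Notation w1001 := [:: true; false; false; true].
Local Notation w1100011 := [:: true; true; false; false; false; true; true].

Section Operators.
Variables (C : numClosedFieldType) (n : nat).
Implicit Types (s t : cfg n) (A B : op C n) (phi psi : {ffun cfg n -> C}).

Definition dot phi psi : C := \sum_t (phi t)^* * psi t.

Lemma dot_ge0 psi : 0 <= dot psi psi.
Proof. by apply: sumr_ge0 => t _; rewrite mulrC -normCK exprn_ge0. Qed.

Lemma dot_eq0 psi : (dot psi psi == 0) = (psi == 0).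
Proof.
apply/idP/eqP => [|->]; last by rewrite /dot big1 // => t _; rewrite ffunE mulr0.
rewrite psumr_eq0 => [/allP psi0|t _]; last by rewrite mulrC -normCK exprn_ge0.
apply/ffunP => t; apply/eqP; have := psi0 t (mem_index_enum t).
by rewrite mulrC -normCK sqrf_eq0 normr_eq0 ffunE.
Qed.

Lemma apply_comp A B psi : apply_op (Defs.comp A B) psi = apply_op A (apply_op B psi).
Proof.
apply/ffunP => t; rewrite !ffunE.
under eq_bigr do rewrite mulr_suml.
rewrite exchange_big; apply: eq_bigr => r _ /=.
by rewrite ffunE mulr_sumr; apply: eq_bigr => s _; rewrite mulrA.
Qed.

Lemma apply_op0 A : apply_op A 0 = 0.
Proof. by apply/ffunP => t; rewrite !ffunE big1 // => s _; rewrite ffunE mulr0. Qed.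

Lemma dot_adj A phi psi : dot phi (apply_op (adj A) psi) = dot (apply_op A phi) psi.
Proof.
rewrite /dot; under eq_bigr do rewrite ffunE mulr_sumr.
rewrite exchange_big; apply: eq_bigr => s _ /=.
rewrite ffunE rmorph_sum mulr_suml; apply: eq_bigr => t _.
by rewrite rmorphM /= mulrCA mulrA.
Qed.

Lemma apply_sum (I : finType) (c : I -> C) (A : I -> op C n) psi t :
  apply_op (fun t s => \sum_i c i * A i t s) psi t
  = \sum_i c i * apply_op (A i) psi t.
Proof.
rewrite ffunE; under eq_bigr do rewrite mulr_suml.
rewrite exchange_big; apply: eq_bigr => i _ /=.
by rewrite ffunE mulr_sumr; apply: eq_bigr => s _; rewrite mulrA.
Qed.

Lemma ker_sum_adj_comp (I : finType) (c : I -> C) (A : I -> op C n) psi :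
  (forall i, 0 < c i) ->
  apply_op (fun t s => \sum_i c i * Defs.comp (adj (A i)) (A i) t s) psi = 0
  <-> forall i, apply_op (A i) psi = 0.
Proof.
move=> c_gt0; split=> [H0 | A0]; last first.
  apply/ffunP => t; rewrite apply_sum ffunE big1 // => i _.
  by rewrite apply_comp A0 apply_op0 ffunE mulr0.
have: \sum_i c i * dot (apply_op (A i) psi) (apply_op (A i) psi) = 0.
  transitivity (dot psi 0); last by rewrite /dot big1 // => t _; rewrite ffunE mulr0.
  rewrite -H0 /dot; under [RHS]eq_bigr do rewrite apply_sum mulr_sumr.
  rewrite [RHS]exchange_big; apply: eq_bigr => i _ /=.
  rewrite -/(dot _ _) -dot_adj -apply_comp mulr_sumr.
  by apply: eq_bigr => t _; rewrite mulrCA.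
move/eqP; rewrite psumr_eq0 => [/allP sum0 i|i _]; last first.
  by rewrite mulr_ge0 ?dot_ge0 ?ltW.
have := sum0 i (mem_index_enum i).
by rewrite /= mulf_eq0 gt_eqF //= dot_eq0 => /eqP.
Qed.

Lemma apply_ket A t s : apply_op A (ket C n (val s)) t = A t s.
Proof.
rewrite ffunE (bigD1 s) //= ffunE eqxx mulr1 big1 ?addr0 // => r /negPf rs.
by rewrite ffunE val_eqE rs mulr0.
Qed.

End Operators.

Section WordKets.
Variable K : pzSemiRingType.
Implicit Types (f g : seq bool -> K) (s v w p : seq bool).

Definition ket_word w s : K := (s == w)%:R.

Lemma ket_word_size w s : size s != size w -> ket_word w s = 0.
Proof. by rewrite /ket_word; have [->|] := eqVneq s w; rewrite ?eqxx. Qed.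

Definition ket_cons (a : bool) f s : K :=
  if s is b :: s' then if a == b then f s' else 0 else 0.

Local Notation ket_cat p f := (foldr ket_cons f p).

Lemma eq_ket_cat p f g s :
  (forall s', s = p ++ s' -> f s' = g s') -> ket_cat p f s = ket_cat p g s.
Proof.
elim: p s => [|a p IH] s /= fg; first exact: fg.
case: s fg => [|b s] //= fg; case: eqP => // ab.
by apply: IH => s' sE; apply: fg; rewrite ab sE.
Qed.

Lemma ket_cat_sum (I : Type) (r : seq I) (c : I -> K) (F : I -> seq bool -> K) p s :
  ket_cat p (fun s' => \sum_(i <- r) c i * F i s') s
  = \sum_(i <- r) c i * ket_cat p (F i) s.
Proof.
elim: p s => //= a p IH [|b s] /=; first by rewrite big1 // => i _; rewrite mulr0.
by case: eqP => // _; rewrite big1 // => i _; rewrite mulr0.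
Qed.

Lemma ket_cat_word p w : ket_cat p (ket_word w) =1 ket_word (p ++ w).
Proof.
rewrite /ket_word; elim: p => //= a p IH [|b s] //=.
by rewrite eqseq_cons [b == a]eq_sym; case: eqP.
Qed.

Lemma ket_cat_eq0 p f s : (forall v, s = p ++ v -> f v = 0) -> ket_cat p f s = 0.
Proof.
move=> f0; rewrite (eq_ket_cat (g := fun=> 0)) //.
by elim: p s {f0} => [|a p IH] [|b s] //=; case: eqP.
Qed.

End WordKets.

Arguments ket_word {K} w s.

Local Notation ket_cat p f := (foldr (@ket_cons _) f p).

Lemma cat3_split (T : Type) (w : seq T) x k : (x + k <= size w)%N ->
  exists u m v, [/\ w = u ++ m ++ v, size u = x & size m = k].
Proof.
move=> le_w; exists (take x w), (take k (drop x w)), (drop k (drop x w)).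
by rewrite !cat_take_drop size_takel ?size_takel ?size_drop //; lia.
Qed.

Section WordCoefficients.
Variables (C : numClosedFieldType) (n : nat).
Implicit Types (s t : cfg n) (psi : {ffun cfg n -> C}) (u v w : seq bool).

Definition word_coef psi w : C := \sum_(t : cfg n | val t == w) psi t.

Lemma word_coef_val psi t : word_coef psi (val t) = psi t.
Proof. by rewrite /word_coef (big_pred1 t). Qed.

Lemma word_coef_size psi w : size w != n -> word_coef psi w = 0.
Proof.
move=> /eqP size_w; rewrite /word_coef big_pred0 // => t.
by apply/eqP => tw; case: size_w; rewrite -tw size_tuple.
Qed.

Lemma word_coef_eq psi phi : word_coef psi =1 word_coef phi -> psi = phi.
Proof. by move=> eq_coef; apply/ffunP => t; rewrite -!word_coef_val. Qed.

Lemma word_coef_sum (I : Type) (r : seq I) (F : I -> {ffun cfg n -> C}) w :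
  word_coef (\sum_(i <- r) F i) w = \sum_(i <- r) word_coef (F i) w.
Proof.
by rewrite exchange_big; apply: eq_bigr => t _; rewrite sum_ffunE.
Qed.

Lemma word_coef0 w : word_coef 0 w = 0.
Proof. by rewrite /word_coef big1 // => t _; rewrite ffunE. Qed.

Lemma word_coefD psi phi w :
  word_coef (psi + phi) w = word_coef psi w + word_coef phi w.
Proof. by rewrite /word_coef -big_split; apply: eq_bigr => t _; rewrite ffunE. Qed.

Lemma word_coefB psi phi w :
  word_coef (psi - phi) w = word_coef psi w - word_coef phi w.
Proof. by rewrite /word_coef -sumrB; apply: eq_bigr => t _; rewrite !ffunE. Qed.

Lemma word_coefZ a psi w : word_coef (vscale a psi) w = a * word_coef psi w.
Proof. by rewrite /word_coef mulr_sumr; apply: eq_bigr => t _; rewrite ffunE. Qed.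

Lemma word_coef_ket u : size u = n -> word_coef (ket C n u) =1 ket_word u.
Proof.
move=> size_u w; have [/eqP size_w|size_w] := eqVneq (size w) n.
  by rewrite -[w]/(val (Tuple size_w)) word_coef_val ffunE.
by rewrite word_coef_size // ket_word_size // size_u.
Qed.

Lemma embed1_word (A : bool -> bool -> C) u a v t s : val t = u ++ a :: v ->
  embed1 (size u) A t s = \sum_(b : bool) A a b * (val s == u ++ b :: v)%:R.
Proof.
move=> tE; pose b0 := site s (size u).
have site_t i : tnth t i = nth false (u ++ a :: v) i by rewrite (tnth_nth false) tE.
have size_s b : size (u ++ b :: v) = size s.
  by rewrite size_tuple -(size_tuple t) [tval t]tE !size_cat.
have agree : [forall i : 'I_n, (val i != size u) ==> (tnth t i == tnth s i)]
    = (val s == u ++ b0 :: v).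
  apply/forallP/eqP => [st | sE i].
    apply: (@eq_from_nth _ false) => [|i]; first by rewrite size_s.
    rewrite size_tuple => lt_in; have := st (Ordinal lt_in).
    rewrite site_t (tnth_nth false) /= !nth_cat.
    case: ltngtP => [_ /eqP // | lt_ui /eqP <- | -> _]; last by rewrite subnn.
    by rewrite -(subnSK lt_ui).
  apply/implyP => ne_i; rewrite site_t (tnth_nth false) [tval s]sE !nth_cat.
  by case: ltngtP ne_i => // lt_ui _; rewrite -(subnSK lt_ui).
have b0E b : val s == u ++ b :: v -> b = b0.
  by move=> /eqP sE; rewrite /b0 /site [tval s]sE nth_cat ltnn subnn.
rewrite /embed1 agree (bigD1 b0) //= big1 ?addr0.
  by rewrite /site [tval t]tE nth_cat ltnn subnn.
by move=> b /eqP ne_b; case: eqP => [/eqP/b0E //|]; rewrite mulr0.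
Qed.

Lemma word_coef_embed1 (A : bool -> bool -> C) psi u a v :
  word_coef (apply_op (embed1 (size u) A) psi) (u ++ a :: v)
  = \sum_(b : bool) A a b * word_coef psi (u ++ b :: v).
Proof.
have [size_w | size_w] := eqVneq (size (u ++ a :: v)) n; last first.
  rewrite word_coef_size // big1 // => b _.
  by rewrite word_coef_size ?mulr0 //; move: size_w; rewrite !size_cat.
pose t : cfg n := Tuple (introT eqP size_w).
have tE : val t = u ++ a :: v by [].
rewrite -tE word_coef_val ffunE.
under eq_bigr do rewrite (embed1_word _ _ tE) mulr_suml.
rewrite exchange_big; apply: eq_bigr => b _ /=.
rewrite /word_coef mulr_sumr [RHS]big_mkcond; apply: eq_bigr => s _ /=.
by case: eqP => _; rewrite ?mulr1 // mulr0 mul0r.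
Qed.

Lemma word_coef_nn psi u a b c v :
  word_coef (apply_op (nn C (size u)) psi) (u ++ [:: a, b, c & v])
  = (a && c)%:R * word_coef psi (u ++ [:: a, b, c & v]).
Proof.
have sz2 : (size u + 2 = size (u ++ [:: a; b]))%N by rewrite size_cat.
rewrite /nn apply_comp word_coef_embed1 !big_bool /nmat /= andbF mul0r addr0 andbT.
case: a sz2 => sz2 /=; last by rewrite !mul0r.
rewrite mul1r sz2.
have -> : u ++ [:: true, b, c & v] = (u ++ [:: true; b]) ++ c :: v by rewrite -catA.
rewrite word_coef_embed1.
by rewrite !big_bool /= andbF mul0r addr0 andbT; case: c; rewrite // !mul0r.
Qed.

Lemma word_coef_smin_comp psi u w v a b :
  word_coef (apply_op (Defs.comp (embed1 (size u) (@smin C))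
               (embed1 (size u + (size w).+1) (@smin C))) psi) (u ++ a :: w ++ b :: v)
  = (~~ a && ~~ b)%:R * word_coef psi (u ++ true :: w ++ true :: v).
Proof.
rewrite apply_comp word_coef_embed1 big_bool /smin andbT andbF /= mul0r addr0.
have -> : (size u + (size w).+1 = size (u ++ true :: w))%N by rewrite size_cat.
rewrite -cat_cons catA word_coef_embed1.
by rewrite big_bool andbT andbF /= mul0r addr0 mulrA -natrM mulnb -!catA.
Qed.

Lemma word_coef_qop lam psi u a b c d v :
  word_coef (apply_op (qop lam (size u)) psi) (u ++ [:: a, b, c, d & v])
  = (~~ b && ~~ c)%:R * word_coef psi (u ++ [:: a, true, true, d & v])
    - lam * ((~~ a && ~~ d)%:R * word_coef psi (u ++ [:: true, b, c, true & v])).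
Proof.
have -> : apply_op (qop lam (size u)) psi
    = apply_op (Defs.comp (embed1 (size u + 1) (@smin C))
                          (embed1 (size u + 2) (@smin C))) psi
      - vscale lam (apply_op (Defs.comp (embed1 (size u) (@smin C))
                                        (embed1 (size u + 3) (@smin C))) psi).
  apply/ffunP => t; rewrite !ffunE mulr_sumr -sumrB; apply: eq_bigr => s _.
  by rewrite /qop mulrBl mulrA.
rewrite word_coefB word_coefZ; congr (_ - lam * _).
  have := word_coef_smin_comp psi (rcons u a) [::] (d :: v) b c.
  by rewrite size_rcons !cat_rcons -addn1 -addnA.
exact: (word_coef_smin_comp psi u [:: b; c]).
Qed.

End WordCoefficients.

Section GroundWordFunctions.
Variables (K : comPzRingType) (lam : K).
Implicit Types (f g : seq bool -> K) (u v s p : seq bool) (a b : bool).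

Record ground (f : seq bool -> K) : Prop := Ground {
  ground_1b1 : forall u b v, f (u ++ [:: true, b, true & v]) = 0;
  ground_0110 : forall u v, f (u ++ w0110 ++ v) = lam * f (u ++ w1001 ++ v)
}.

Lemma ground_cons f :
  (forall b v, f [:: true, b, true & v] = 0) ->
  (forall v, f (w0110 ++ v) = lam * f (w1001 ++ v)) ->
  (forall a, ground (fun s => f (a :: s))) -> ground f.
Proof.
move=> f_1b1 f_0110 gf; split=> [[|a u] b v | [|a u] v].
- exact: f_1b1.
- exact: (ground_1b1 (gf a)).
- exact: f_0110.
- exact: (ground_0110 (gf a)).
Qed.

Lemma ground_suffix f p : ground f -> ground (fun s => f (p ++ s)).
Proof. by move=> gf; split=> *; rewrite !(catA p) ?ground_1b1 ?ground_0110. Qed.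

Lemma eq_ground f g : f =1 g -> ground f -> ground g.
Proof. by move=> fg gf; split=> *; rewrite -!fg ?(ground_1b1 gf) ?(ground_0110 gf). Qed.

Lemma ground0 : ground (fun=> 0).
Proof. by split=> *; rewrite ?mulr0. Qed.

Lemma ground_lin c f g : ground f -> ground g -> ground (fun s => c * f s + g s).
Proof.
move=> gf gg; split=> *; first by rewrite !ground_1b1 ?mulr0 ?addr0.
by rewrite !ground_0110 // mulrDr mulrCA.
Qed.

Lemma groundB f g : ground f -> ground g -> ground (fun s => f s - g s).
Proof.
move=> gf gg; apply: eq_ground (ground_lin (-1) gg gf) => s.
by rewrite mulN1r addrC.
Qed.

Lemma ground_sum (I : Type) (P : pred I) (r : seq I) (c : I -> K)
    (F : I -> seq bool -> K) :
  all P r -> (forall i, P i -> ground (F i)) ->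
  ground (fun s => \sum_(i <- r) c i * F i s).
Proof.
move=> /[swap] gF; elim: r => [_|i r IH /= /andP[/gF gi /IH gr]].
  by apply: eq_ground ground0 => s; rewrite big_nil.
by apply: eq_ground (ground_lin (c i) gi gr) => s; rewrite big_cons.
Qed.

Lemma ground_ket0 f :
  ground f -> (forall v, f [:: true, true, false & v] = 0) -> ground (ket_cons false f).
Proof.
move=> gf f_110; apply: ground_cons => [//|v|[|]] /=; last exact: gf.
  by rewrite f_110 mulr0.
exact: ground0.
Qed.

Lemma ground_ket1 f : ground f ->
  (forall b v, f [:: b, true & v] = 0) ->
  (forall v, f [:: false, false, true & v] = 0) -> ground (ket_cons true f).
Proof.
move=> gf f_b1 f_001; apply: ground_cons => [b v|v|[|]] /=; last exact: ground0.
- exact: f_b1.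
- by rewrite f_001 mulr0.
- exact: gf.
Qed.

Lemma ground_ket11000 f : ground f -> (forall v, f [:: true, true, false & v] = 0) ->
  ground (ket_cat [:: true; true; false; false; false] f).
Proof.
move=> gf f_110.
have g000 : ground (ket_cat [:: false; false; false] f).
  by do 3!apply: ground_ket0 => //.
by do 2!apply: ground_ket1 => [|[]|] //.
Qed.

Lemma ground_word_nil : ground (ket_word [::]).
Proof. by split=> [[]|[]] *; rewrite /ket_word /= ?mulr0. Qed.

Lemma ground_word_1 : ground (ket_cons true (ket_word [::])).
Proof. by apply: ground_ket1 ground_word_nil _ _ => [[]|]. Qed.

(* The ground states in which no left boundary dimer occurs. *)
Definition right_ground f : Prop :=
  ground f /\ forall v, f [:: true, true & v] = 0.

End GroundWordFunctions.

Section RootTilings.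
Implicit Types (R : seq tile) (t : tile).

Fixpoint right_root R : bool :=
  if R isn't t :: R' then true else
  if is_void_or_mono t then right_root R' else is_right_last t && nilp R'.

Lemma right_root_ind (P : seq tile -> Prop) :
  P [::] -> (forall t, is_right_last t -> P [:: t]) ->
  (forall R, right_root R -> P R -> P (Void :: R)) ->
  (forall R, right_root R -> P R -> P (Mono :: R)) ->
  forall R, right_root R -> P R.
Proof.
move=> Pnil Plast Pvoid Pmono; elim=> [//|t R IH] /=.
case: ifP => [|_ /andP[t_last /nilP ->]]; last exact: Plast.
case: t => // _ rR; first exact: Pvoid (IH rR).
exact: Pmono (IH rR).
Qed.

Lemma right_rootP R : right_root R <-> exists mid suf, [/\ R = mid ++ suf,
  all is_void_or_mono mid & suf = [::] \/ exists t, suf = [:: t] /\ is_right_last t].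
Proof.
split=> [|[mid [suf [-> mid_vm suf_or]]]]; last first.
  elim: mid mid_vm => [_|t mid IH /= /andP[-> /IH] //].
  by case: suf_or => [->|[[] [->]]].
move: R; apply: right_root_ind => [|t t_last|R _|R _].
- by exists [::], [::]; split=> //; left.
- by exists [::], [:: t]; split=> //; right; exists t.
- by case=> mid [suf [-> mid_vm suf_or]]; exists (Void :: mid), suf.
- by case=> mid [suf [-> mid_vm suf_or]]; exists (Mono :: mid), suf.
Qed.

Definition is_root R : bool :=
  if R is LBDimer :: R' then right_root R' else right_root R.

Definition is_root_tiling n R : bool := is_root R && (size (tiling_content R) == n).

Lemma root_tilingP n R : reflect (root_tiling n R) (is_root_tiling n R).
Proof.
apply: (iffP andP) => [[rR /eqP size_R]|]; last first.
  move=> [pre [mid [suf [-> [pre_or [mid_vm [suf_or ->]]]]]]]; rewrite eqxx.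
  have rR : right_root (mid ++ suf) by apply/right_rootP; exists mid, suf.
  by case: pre_or => -> //=; split=> //; case: (mid ++ suf) rR => // - [].
have [pre [R' [RE pre_or]]] : exists pre R', [/\ R = pre ++ R',
    pre = [::] \/ pre = [:: LBDimer] & right_root R'].
  case: R rR {size_R} => [|[] R] rR;
    try by eexists [::], _; split; [by [] | left | exact: rR].
  by exists [:: LBDimer], R; split=> //; right.
move=> /right_rootP[mid [suf [R'E mid_vm suf_or]]].
by exists pre, mid, suf; rewrite -R'E -RE.
Qed.

End RootTilings.

Section TilingAmplitudes.
Variables (K : comPzRingType) (lam : K).
Implicit Types (f g : seq bool -> K) (s v w : seq bool) (R D : seq tile) (t : tile).

Definition amplitude R s : K :=
  \sum_(D <- derive R) lam ^+ count is_dimerlike D * ket_word (tiling_content D) s.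

(* A monomer followed by a tile starting with 1 may be exchanged 1001 -> 0110 at
   the cost of a factor lam; this accounts at once for dimers and for both
   truncated dimers. *)
Definition add_tile t f s : K :=
  lam ^+ is_dimerlike t * ket_cat (content t) f s
  + (if t is Mono then lam * ket_cat w0110 (fun v => f (true :: v)) s else 0).

Lemma amplitude_nil : amplitude [::] =1 ket_word [::].
Proof. by move=> s; rewrite /amplitude big_seq1 mul1r. Qed.

Lemma derive_cons t R :
  derive (t :: R) = [seq t :: D | D <- derive R] ++
    match t, R with
    | Mono, Mono :: R' => [seq Dimer :: D | D <- derive R']
    | Mono, RMono1 :: R' => [seq Trunc1 :: D | D <- derive R']
    | Mono, RMono2 :: R' => [seq Trunc2 :: D | D <- derive R']
    | _, _ => [::]
    end.
Proof. by []. Qed.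

Lemma sum_derive_cons t (Ds : seq (seq tile)) s :
  \sum_(D <- [seq t :: D | D <- Ds])
    lam ^+ count is_dimerlike D * ket_word (tiling_content D) s =
  lam ^+ is_dimerlike t * ket_cat (content t) (fun v =>
    \sum_(D <- Ds) lam ^+ count is_dimerlike D * ket_word (tiling_content D) v) s.
Proof.
rewrite big_map ket_cat_sum mulr_sumr; apply: eq_bigr => D _.
by rewrite /= exprD mulrA ket_cat_word.
Qed.

Lemma amplitude_cons t R s :
  right_root R -> amplitude (t :: R) s = add_tile t (amplitude R) s.
Proof.
elim: R t s => [|t' R IH] t s rR;
  rewrite {1}/amplitude derive_cons big_cat sum_derive_cons; congr (_ + _);
  case: t => /=; rewrite ?big_nil // -/(ket_cat w0110 _ s).
  by rewrite ket_cat_eq0 ?mulr0 // => v _; rewrite amplitude_nil.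
have amplitude_true v : amplitude (t' :: R) (true :: v) =
    if head false (content t') then ket_cat (behead (content t')) (amplitude R) v
    else 0.
  rewrite IH; last by case: t' rR => //= /nilP ->.
  by case: t' rR => //= _; rewrite /add_tile /= ?mulr0 ?mul1r ?addr0.
rewrite (eq_ket_cat (fun v _ => amplitude_true v)) {amplitude_true}.
by case: t' rR => // _; rewrite ?big_nil ?sum_derive_cons // ket_cat_eq0 ?mulr0.
Qed.

Lemma amplitude_right_11 R v : right_root R -> amplitude R [:: true, true & v] = 0.
Proof.
move: R; apply: right_root_ind => [|t t_last|R rR _|R rR _].
- by rewrite amplitude_nil.
- rewrite amplitude_cons //; case: t t_last => // _;
  by rewrite /add_tile /= ?amplitude_nil ?mulr0 ?addr0.
- by rewrite amplitude_cons // /add_tile /= mulr0 addr0.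
- by rewrite amplitude_cons // /add_tile /= !mulr0 addr0.
Qed.

Lemma ground_add_mono f : right_ground lam f -> ground lam (add_tile Mono f).
Proof.
move=> [gf f_11]; pose h v := f (true :: v).
have gh : ground lam h by apply: (ground_suffix [:: true] gf).
have h_1 v : h (true :: v) = 0 by apply: f_11.
have h_01 v : h [:: false, true & v] = 0 by apply: (ground_1b1 gf [::]).
apply: ground_cons => [b v|v|[|]]; rewrite /add_tile /=.
- by case: b; rewrite !mulr0 addr0.
- by rewrite !mulr0 add0r addr0 mul1r.
- apply: (@eq_ground _ _ (ket_cat [:: false; false] f)) => [s|].
    by rewrite mul1r mulr0 addr0.
  by apply: ground_ket0 => [|//]; apply: ground_ket0 => // v; exact: f_11.
- have g110 : ground lam (ket_cat [:: true; true; false] h).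
    have g0 : ground lam (ket_cons false h) by apply: ground_ket0 => // v; exact: h_1.
    by apply: ground_ket1 => [|[]|] //; apply: ground_ket1 => // [[]].
  apply: eq_ground (ground_lin lam g110 (ground0 lam)) => s.
  by rewrite mulr0 add0r addr0.
Qed.

Lemma amplitude_right_last t :
  is_right_last t -> amplitude [:: t] =1 ket_word (content t).
Proof.
move=> t_last s; rewrite amplitude_cons // -[content t]cats0 -ket_cat_word.
have -> : add_tile t (amplitude [::]) s = ket_cat (content t) (amplitude [::]) s.
  by case: t t_last => // _; rewrite /add_tile mul1r addr0.
by apply: eq_ket_cat => v _; rewrite amplitude_nil.
Qed.

Lemma right_ground_amplitude R : right_root R -> right_ground lam (amplitude R).
Proof.
move=> rR; split=> [|v]; last exact: amplitude_right_11.
move: R rR; apply: right_root_ind => [|t t_last|R rR gR|R rR gR].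
- by apply: eq_ground (ground_word_nil lam) => s; rewrite amplitude_nil.
- apply: (@eq_ground _ _ (ket_cat (content t) (ket_word [::]))) => [s|].
    by rewrite ket_cat_word cats0 amplitude_right_last.
  have [g_nil g_1] := (ground_word_nil lam, ground_word_1 lam).
  case: t t_last => // _.
  + by apply: ground_ket0 => //; apply: ground_ket1 => // [[]].
  + by apply: ground_ket1 => [|[]|] //; apply: ground_ket0.
- apply: (@eq_ground _ _ (ket_cons false (amplitude R))) => [s|].
    by rewrite amplitude_cons // /add_tile mul1r addr0.
  by apply: ground_ket0 => // v; exact: amplitude_right_11.
- apply: (eq_ground (fun s => esym (amplitude_cons Mono s rR))).
  by apply: ground_add_mono; split=> // v; exact: amplitude_right_11.
Qed.

Lemma ground_amplitude R : is_root R -> ground lam (amplitude R).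
Proof.
case: R => [|[] R] rR; try by have [] := right_ground_amplitude rR.
pose f s := lam * ket_cat (content LBDimer) (amplitude R) s + 0.
apply: (@eq_ground _ _ f) => [s|].
  by rewrite amplitude_cons.
have [gR R_11] := right_ground_amplitude rR.
by apply: ground_lin (ground0 lam); apply: ground_ket11000.
Qed.

Lemma amplitude_1100011 R : is_root R -> amplitude R w1100011 = 0.
Proof.
case: R => [|[] R] rR; try exact: amplitude_right_11.
by rewrite amplitude_cons // /add_tile /= amplitude_right_11 // mulr0 addr0.
Qed.

Lemma add_tile_size R t f s :
  (forall v, size v != size (tiling_content R) -> f v = 0) ->
  size s != size (tiling_content (t :: R)) -> add_tile t f s = 0.
Proof.
rewrite -[tiling_content (t :: R)]/(content t ++ tiling_content R) size_cat.
move=> f_size ne_s; rewrite /add_tile ket_cat_eq0 ?mulr0 ?add0r => [|v sE]; last first.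
  by apply: f_size; apply: contra ne_s => /eqP <-; rewrite sE size_cat.
case: t ne_s => // ne_s; rewrite ket_cat_eq0 ?mulr0 // => v sE.
by apply: f_size; apply: contra ne_s => /eqP <-; rewrite sE.
Qed.

Lemma amplitude_right_size R s :
  right_root R -> size s != size (tiling_content R) -> amplitude R s = 0.
Proof.
move=> rR; move: R rR s.
apply: right_root_ind => [s|t t_last s|R rR IH s|R rR IH s] ne_s.
- by rewrite amplitude_nil ket_word_size.
- by rewrite amplitude_right_last // ket_word_size // -[content t]cats0.
- by rewrite amplitude_cons //; apply: add_tile_size IH ne_s.
- by rewrite amplitude_cons //; apply: add_tile_size IH ne_s.
Qed.

Lemma amplitude_size R s :
  is_root R -> size s != size (tiling_content R) -> amplitude R s = 0.
Proof.
case: R => [|[] R] rR; try exact: amplitude_right_size.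
by rewrite amplitude_cons //; apply: add_tile_size => v; exact: amplitude_right_size.
Qed.

End TilingAmplitudes.

Section Spanning.
Variables (K : fieldType) (lam : K).
Implicit Types (f g : seq bool -> K) (s v : seq bool) (t : tile) (k : nat).
Implicit Types (P Q : pred (seq tile)).

Definition tiling_span (P : pred (seq tile)) k f : Prop :=
  exists2 rs : seq (K * seq tile), all (fun p => P p.2) rs &
    forall s, (size s < k)%N -> f s = \sum_(p <- rs) p.1 * amplitude lam p.2 s.

Lemma tiling_span_lin P k c f g :
  tiling_span P k f -> tiling_span P k g -> tiling_span P k (fun s => c * f s + g s).
Proof.
move=> [rf Pf fE] [rg Pg gE].
exists ([seq (c * p.1, p.2) | p <- rf] ++ rg) => [|s lt_sk].
  by rewrite all_cat all_map Pg andbT.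
rewrite fE // gE // big_cat big_map mulr_sumr; congr (_ + _).
by apply: eq_bigr => p _; rewrite mulrA.
Qed.

Lemma eq_tiling_span P k f g : f =1 g -> tiling_span P k f -> tiling_span P k g.
Proof. by move=> fg [rs Prs fE]; exists rs => // s; rewrite -fg; apply: fE. Qed.

Lemma tiling_spanD P k f g :
  tiling_span P k f -> tiling_span P k g -> tiling_span P k (fun s => f s + g s).
Proof.
move=> Pf Pg; apply: eq_tiling_span (tiling_span_lin 1 Pf Pg) => s.
by rewrite mul1r.
Qed.

Lemma tiling_span_sub P Q k f : subpred P Q ->
  tiling_span P k f -> tiling_span Q k f.
Proof.
by move=> PQ [rs Prs fE]; exists rs => //; apply: sub_all Prs => p; apply: PQ.
Qed.

Lemma tiling_span_sum P k (Rs : seq (seq tile)) (c : seq tile -> K) :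
  all P Rs -> tiling_span P k (fun s => \sum_(R <- Rs) c R * amplitude lam R s).
Proof.
by move=> PRs; exists [seq (c R, R) | R <- Rs] => [|s _]; rewrite ?all_map // big_map.
Qed.

Lemma eq_add_tile t f g s : (forall v, (size v < size s)%N -> f v = g v) ->
  add_tile lam t f s = add_tile lam t g s.
Proof.
move=> fg; rewrite /add_tile; congr (_ * _ + _).
  apply: eq_ket_cat => v sE; apply: fg.
  by rewrite sE size_cat -[X in (X < _)%N]add0n ltn_add2r; case: t {sE}.
case: t => //; congr (_ * _); apply: eq_ket_cat => v sE.
by apply: fg; rewrite sE /=; lia.
Qed.

Lemma add_tile_sum (I : Type) (r : seq I) (c : I -> K) (F : I -> seq bool -> K) t s :
  add_tile lam t (fun v => \sum_(i <- r) c i * F i v) s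
  = \sum_(i <- r) c i * add_tile lam t (F i) s.
Proof.
rewrite /add_tile ket_cat_sum; under [RHS]eq_bigr do rewrite mulrDr mulrCA.
rewrite big_split -mulr_sumr; congr (_ + _).
case: t; try by rewrite big1 // => i _; rewrite mulr0.
by rewrite ket_cat_sum mulr_sumr; apply: eq_bigr => i _; rewrite mulrCA.
Qed.

Lemma tiling_span_add_tile P t k f :
  (forall R, right_root R -> P (t :: R)) ->
  tiling_span right_root k f -> tiling_span P k.+1 (add_tile lam t f).
Proof.
move=> Pt [rs rrs fE]; exists [seq (p.1, t :: p.2) | p <- rs] => [|s lt_sk].
  by rewrite all_map; apply: sub_all rrs => p; apply: Pt.
rewrite (@eq_add_tile t f (fun v => \sum_(p <- rs) p.1 * amplitude lam p.2 v)).
2: by move=> v lt_vs; apply: fE; apply: leq_trans lt_vs _.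
rewrite add_tile_sum big_map.
elim: rs rrs {fE} => [|p rs IH] /=; first by rewrite !big_nil.
by case/andP=> rp /IH sumE; rewrite !big_cons sumE amplitude_cons.
Qed.

Lemma right_ground_peel f : lam != 0 -> right_ground lam f ->
  exists f_mono f_void, [/\ right_ground lam f_mono, right_ground lam f_void &
    forall s, f s = add_tile lam Mono f_mono s + add_tile lam Void f_void s
      + \sum_(R <- [:: [::]; [:: RMono1]; [:: RMono2]; [:: RDimer]])
          f (tiling_content R) * amplitude lam R s].
Proof.
move=> lam0 [gf f_11].
pose f_mono s := f [:: true, false, false & s].
pose g s := f s - add_tile lam Mono f_mono s.
pose f_void s :=
  - f [:: false; true; true] * amplitude lam [:: RDimer] (false :: s) + g (false :: s).
have f_101 v : f [:: true, false, true & v] = 0 by apply: (ground_1b1 gf [::]).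
have f_0110 v : f (w0110 ++ v) = lam * f_mono (true :: v).
  exact: (ground_0110 gf [::]).
have f_monoP : right_ground lam f_mono.
  split=> [|v]; first exact: (ground_suffix [:: true; false; false] gf).
  apply/eqP; have := ground_0110 gf [::] (true :: v).
  rewrite (ground_1b1 gf [:: false; true]) => /esym/eqP.
  by rewrite mulf_eq0 (negPf lam0).
have g_ground : ground lam g by apply: groundB gf (ground_add_mono f_monoP).
exists f_mono, f_void; split=> // [|s].
  split=> [|v].
    have g_dimer : ground lam (amplitude lam [:: RDimer]) by apply: ground_amplitude.
    exact: ground_lin (ground_suffix [:: false] g_dimer)
                      (ground_suffix [:: false] g_ground).
  rewrite /f_void /g amplitude_right_last // /add_tile /ket_word /=; case: v => [|[] v].
  - by rewrite !(mulr0, addr0, subr0, mulr1) addNr.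
  - by rewrite (ground_1b1 gf [:: false]) !(mulr0, addr0, subr0).
  - by rewrite f_0110 !(mulr0, add0r) subrr.
rewrite !big_cons big_nil addr0 amplitude_nil !amplitude_right_last //.
rewrite /add_tile /ket_word.
pose simp := (mulr0, mul1r, mulr1, addr0, add0r).
case: s => [|[] s] /=; first by rewrite !simp.
  case: s => [|[] s]; rewrite ?f_11 /= ?simp //.
  by case: s => [|[] s]; rewrite ?f_101 /= !simp.
rewrite /f_void /g amplitude_right_last //= /add_tile /ket_word /= !simp.
ring.
Qed.

Lemma right_ground_span f k :
  lam != 0 -> right_ground lam f -> tiling_span right_root k f.
Proof.
move=> lam0; elim: k f => [|k IH] f gf; first by exists [::].
have [f_mono [f_void [g_mono g_void fE]]] := right_ground_peel lam0 gf.
apply: (eq_tiling_span (fun s => esym (fE s))); do 2?apply: tiling_spanD.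
- exact: tiling_span_add_tile (IH _ g_mono).
- exact: tiling_span_add_tile (IH _ g_void).
- exact: tiling_span_sum.
Qed.

Lemma ground_span f k : lam != 0 -> ground lam f ->
  f [:: true; true] = 0 -> f [:: true; true; false] = 0 ->
  f [:: true; true; false; false] = 0 -> f w1100011 = 0 ->
  tiling_span is_root k f.
Proof.
move=> lam0 gf f_11 f_110 f_1100 f_1100011.
have f_1b1 b v : f [:: true, b, true & v] = 0 by apply: (ground_1b1 gf [::]).
have f_11001 v : f [:: true, true, false, false, true & v] = 0.
  have := ground_0110 gf [:: true] v; rewrite (f_1b1 false) => /esym/eqP.
  by rewrite mulf_eq0 (negPf lam0) => /eqP.
pose h v := f (content LBDimer ++ v).
have [gh h_11] : right_ground lam h.
  split=> [|[|[] v]]; first exact: (ground_suffix (content LBDimer) gf).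
  - exact: f_1100011.
  - exact: (ground_1b1 gf (content LBDimer)).
  - have := ground_0110 gf [:: true; true; false; false] v.
    by rewrite f_11001 mulr0.
pose g s := f s - ket_cat (content LBDimer) h s.
have g_right : right_ground lam g.
  split=> [|v]; first by apply: groundB gf (ground_ket11000 gh _) => v; apply: h_11.
  rewrite /g; case: v => [|[] v] /=; rewrite ?f_1b1 ?f_11 ?subr0 //.
  case: v => [|[] v] /=; rewrite ?(ground_1b1 gf [:: true]) ?f_110 ?subr0 //.
  by case: v => [|[] v] /=; rewrite ?f_11001 ?f_1100 ?subr0 ?subrr.
have h_span : tiling_span is_root k (add_tile lam LBDimer h).
  case: k => [|k]; first by exists [::].
  by apply: tiling_span_add_tile (right_ground_span k lam0 _).
have g_span : tiling_span is_root k g.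
  by apply: tiling_span_sub (right_ground_span k lam0 g_right) => - [|[] R].
apply: eq_tiling_span (tiling_span_lin lam^-1 h_span g_span) => s.
by rewrite /add_tile addr0 mulKf // /g addrC subrK.
Qed.

End Spanning.

Section GroundSpace.
Variables (C : numClosedFieldType) (n : nat).
Implicit Types (kappa lam : C) (psi phi : {ffun cfg n -> C}) (R : seq tile).

Lemma nnE x (t s : cfg n) : (x + 2 < n)%N ->
  nn C x t s = (site t x && site t (x + 2))%:R * (t == s)%:R.
Proof.
move=> lt_xn; rewrite -apply_ket -word_coef_val.
have lt_xt : (x + 3 <= size (val t))%N by rewrite size_tuple; lia.
have [u [m [v [tE <- +]]]] := cat3_split lt_xt; case: m tE => [|a [|b [|c []]]] // tE _.
rewrite {1}tE word_coef_nn -tE word_coef_val ffunE val_eqE /site [tval t]tE.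
by rewrite !nth_cat ltnn subnn [X in if X then _ else _]ltnNge leq_addr addKn.
Qed.

Lemma adj_nn_comp x (t s : cfg n) : (x + 2 < n)%N ->
  Defs.comp (adj (nn C x)) (nn C x) t s = nn C x t s.
Proof.
move=> lt_xn; rewrite /Defs.comp (bigD1 t) //= big1 => [|r /negPf ne_rt].
  by rewrite addr0 /adj !nnE // eqxx mulr1 conjC_nat mulrA -natrM mulnb andbb.
by rewrite /adj nnE // ne_rt mulr0 conjC0 mul0r.
Qed.

Definition Ham_factor lam (i : 'I_(n - 2) + 'I_(n - 3)) : op C n :=
  match i with inl x => nn C x | inr x => qop lam x end.

Definition Ham_weight kappa (i : 'I_(n - 2) + 'I_(n - 3)) : C :=
  if i is inl _ then 1 else kappa.

Lemma HamE kappa lam (t s : cfg n) :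
  Ham kappa lam t s =
  \sum_i Ham_weight kappa i * Defs.comp (adj (Ham_factor lam i)) (Ham_factor lam i) t s.
Proof.
rewrite big_sumType /= /Ham !big_mkord mulr_sumr; congr (_ + _).
by apply: eq_bigr => x _; rewrite mul1r adj_nn_comp //; case: x => x /= ?; lia.
Qed.

Lemma in_ker_local kappa lam psi : 0 < kappa -> in_ker kappa lam psi <->
  (forall x, (x + 2 < n)%N -> apply_op (nn C x) psi = 0) /\
  (forall x, (x + 3 < n)%N -> apply_op (qop lam x) psi = 0).
Proof.
move=> kappa_gt0.
have weight_gt0 i : 0 < Ham_weight kappa i by case: i => _ //=; exact: ltr01.
have -> : in_ker kappa lam psi <-> forall i, apply_op (Ham_factor lam i) psi = 0.
  rewrite -(ker_sum_adj_comp _ _ weight_gt0) /in_ker.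
  suff -> : apply_op (Ham kappa lam) psi = apply_op (fun t s =>
      \sum_i Ham_weight kappa i *
        Defs.comp (adj (Ham_factor lam i)) (Ham_factor lam i) t s) psi by [].
  by apply/ffunP => t; rewrite !ffunE; apply: eq_bigr => s _; rewrite HamE.
split=> [factor0|[nn0 q0] [[x lt_x]|[x lt_x]]].
- split=> x lt_x.
    have lt_x2 : (x < n - 2)%N by lia.
    exact: (factor0 (inl (Ordinal lt_x2))).
  have lt_x3 : (x < n - 3)%N by lia.
  exact: (factor0 (inr (Ordinal lt_x3))).
- by apply: nn0 => /=; lia.
- by apply: q0 => /=; lia.
Qed.

Lemma nn_kerP psi :
  (forall x, (x + 2 < n)%N -> apply_op (nn C x) psi = 0) <->
  forall u b v, word_coef psi (u ++ [:: true, b, true & v]) = 0.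
Proof.
split=> [nn0 u b v|coef_1b1 x lt_x].
  have [size_w|] := eqVneq (size (u ++ [:: true, b, true & v])) n.
    have := word_coef_nn psi u true b true v.
    rewrite nn0 ?word_coef0 ?mul1r => [//|]; move: size_w; rewrite size_cat /=; lia.
  exact: word_coef_size.
apply: word_coef_eq => w; rewrite word_coef0.
have [size_w|] := eqVneq (size w) n; last exact: word_coef_size.
have lt_xw : (x + 3 <= size w)%N by lia.
have [u [m [v [-> <- +]]]] := cat3_split lt_xw; case: m => [|a [|b [|c []]]] // _.
rewrite word_coef_nn; case: a c => [] []; rewrite ?mul0r //.
by rewrite coef_1b1 mulr0.
Qed.

Lemma qop_kerP lam psi :
  (forall u b v, word_coef psi (u ++ [:: true, b, true & v]) = 0) ->
  (forall x, (x + 3 < n)%N -> apply_op (qop lam x) psi = 0) <->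
  forall u v, word_coef psi (u ++ w0110 ++ v) = lam * word_coef psi (u ++ w1001 ++ v).
Proof.
move=> coef_1b1; split=> [q0 u v|coef_0110 x lt_x].
  have [size_w|size_w] := eqVneq (size (u ++ w0110 ++ v)) n.
    have := word_coef_qop lam psi u false false false false v.
    rewrite q0 ?word_coef0 ?mul1r => [/esym/subr0_eq //|].
    by move: size_w; rewrite size_cat /=; lia.
  rewrite !word_coef_size ?mulr0 //; by move: size_w; rewrite !size_cat.
apply: word_coef_eq => w; rewrite word_coef0.
have [size_w|] := eqVneq (size w) n; last exact: word_coef_size.
have lt_xw : (x + 4 <= size w)%N by lia.
have [u [m [v [-> <- +]]]] := cat3_split lt_xw.
case: m => [|a [|b [|c [|d []]]]] // _; rewrite word_coef_qop -!negb_or.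
have coef_a11d : a || d -> word_coef psi (u ++ [:: a, true, true, d & v]) = 0.
  case: a => [_|/= ->]; first exact: coef_1b1.
  by rewrite -cat_rcons coef_1b1.
have coef_1bc1 : b || c -> word_coef psi (u ++ [:: true, b, c, true & v]) = 0.
  case: c => [_|]; first exact: coef_1b1.
  by rewrite orbF => ->; rewrite -cat_rcons coef_1b1.
have [/coef_a11d ->|] := boolP (a || d).
  by have [/coef_1bc1 ->|] := boolP (b || c); rewrite !(mulr0, mul0r) subrr.
have [/coef_1bc1 ->|] := boolP (b || c); first by rewrite !(mulr0, mul0r) subrr.
case: a b c d {coef_a11d coef_1bc1} => [] [] [] [] // _ _.
by rewrite coef_0110 !mul1r subrr.
Qed.

Lemma in_ker_groundP kappa lam psi :
  0 < kappa -> in_ker kappa lam psi <-> ground lam (word_coef psi).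
Proof.
move=> /in_ker_local kerP; rewrite kerP nn_kerP.
split=> [[coef_1b1 /(qop_kerP _ coef_1b1)] | [coef_1b1 coef_0110]]; first by split.
by split=> //; apply/qop_kerP.
Qed.

Lemma word_coef_psiR lam R :
  root_tiling n R -> word_coef (psiR n lam R) =1 amplitude lam R.
Proof.
move=> /root_tilingP/andP[rR /eqP size_R] s.
have [/eqP size_s|size_s] := eqVneq (size s) n; last first.
  by rewrite word_coef_size // amplitude_size // size_R.
rewrite -[s]/(val (Tuple size_s)) word_coef_val /psiR sum_ffunE.
by apply: eq_bigr => D _; rewrite !ffunE.
Qed.

Lemma in_G_amplitudeP lam psi : in_G lam psi <->
  exists2 rs : seq (C * seq tile),
    all (fun p => is_root_tiling n p.2) rs &
    word_coef psi =1 fun s => \sum_(p <- rs) p.1 * amplitude lam p.2 s.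
Proof.
have rootsE (rs : seq (C * seq tile)) :
  (forall i, (i < size rs)%N -> root_tiling n (nth (0, [::]) rs i).2) <->
  all (fun p => is_root_tiling n p.2) rs.
  split=> [rts|/(all_nthP (0, [::])) rts i lt_i]; last exact/root_tilingP/rts.
  by apply/(all_nthP (0, [::])) => i /rts /root_tilingP.
have sumE (rs : seq (C * seq tile)) :
    all (fun p => is_root_tiling n p.2) rs ->
    word_coef (\sum_(p <- rs) vscale p.1 (psiR n lam p.2))
    =1 fun s => \sum_(p <- rs) p.1 * amplitude lam p.2 s.
  move=> rts s; rewrite word_coef_sum.
  elim: rs rts => [|p rs IH] /=; first by rewrite !big_nil.
  move=> /andP[/root_tilingP rp /IH sumE]; rewrite !big_cons sumE.
  by rewrite word_coefZ word_coef_psiR.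
split=> [[rs [/rootsE rts ->]]|[rs rts psiE]]; exists rs => //; first exact: sumE.
split; first exact/rootsE.
by apply: word_coef_eq => s; rewrite psiE sumE.
Qed.

Lemma in_G_ground lam psi : in_G lam psi -> ground lam (word_coef psi).
Proof.
move=> /in_G_amplitudeP[rs rts psiE]; apply: (eq_ground (fsym psiE)).
by apply: ground_sum rts _ => p /andP[rp _]; apply: ground_amplitude.
Qed.

Lemma in_G_1100011 lam psi : in_G lam psi -> word_coef psi w1100011 = 0.
Proof.
move=> /in_G_amplitudeP[rs rts ->].
elim: rs rts => [|p rs IH] /=; first by rewrite big_nil.
case/andP=> /andP[rp _] /IH sum0.
by rewrite big_cons sum0 addr0 amplitude_1100011 ?mulr0.
Qed.

Lemma ground_in_G lam psi : (5 <= n)%N -> lam != 0 -> ground lam (word_coef psi) ->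
  word_coef psi w1100011 = 0 -> in_G lam psi.
Proof.
move=> n_ge5 lam0 g_psi psi_1100011.
have short w : (size w < 5)%N -> word_coef psi w = 0.
  by move=> lt_w; apply: word_coef_size; rewrite neq_ltn (leq_trans lt_w).
have [rs rrs psiE] := ground_span n.+1 lam0 g_psi (short [:: true; true] erefl)
  (short [:: true; true; false] erefl) (short [:: true; true; false; false] erefl)
  psi_1100011.
apply/in_G_amplitudeP; exists [seq p <- rs | size (tiling_content p.2) == n] => [|s].
  rewrite all_filter; apply: sub_all rrs => p /= rp.
  by rewrite /is_root_tiling rp; apply/implyP.
have sumE : \sum_(p <- rs | size (tiling_content p.2) == n) p.1 * amplitude lam p.2 s
    = if size s == n then \sum_(p <- rs) p.1 * amplitude lam p.2 s else 0.
  elim: rs rrs {psiE} => [|p rs IH] /=; first by rewrite !big_nil if_same.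
  move=> /andP[rp /IH sumE]; rewrite !big_cons sumE.
  have [size_s|size_s] := eqVneq (size s) n; last first.
    by case: eqP => // size_p; rewrite amplitude_size ?mulr0 ?addr0 // size_p.
  by case: eqP => // /eqP size_p; rewrite amplitude_size ?mulr0 ?add0r // size_s eq_sym.
rewrite big_filter sumE; case: ifP => [/eqP size_s|/negbT]; last exact: word_coef_size.
by rewrite psiE // size_s.
Qed.

Lemma ground_ket_1100011 lam : n = 7 -> ground lam (word_coef (ket C n w1100011)).
Proof.
move=> n7; apply: (@eq_ground _ _ (ket_cat (content LBDimer)
    (ket_cat [:: true; true] (ket_word [::])))) => [s|].
  by rewrite -foldr_cat ket_cat_word word_coef_ket.
by apply: ground_ket11000 => //; apply: ground_ket1 (ground_word_1 lam) _ _ => // - [].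
Qed.

End GroundSpace.

Theorem theorem2p15 (C : numClosedFieldType) (kappa lam : C) :
  0 < kappa -> lam != 0 ->
  (forall n : nat, (8 <= n)%N \/ n = 5%N \/ n = 6%N ->
     forall psi : {ffun cfg n -> C}, in_ker kappa lam psi <-> in_G lam psi) /\
  ((forall psi : {ffun cfg 7 -> C},
      in_ker kappa lam psi <->
      exists phi c, in_G lam phi /\
        psi = phi + vscale c (ket C 7 [:: true; true; false; false; false; true; true])) /\
   (forall c : C,
      in_G lam (vscale c (ket C 7 [:: true; true; false; false; false; true; true])) -> c = 0)).
Proof.
move=> kappa_gt0 lam0; split=> [n n_range psi|]; last split=> [psi|c G_ket].
- rewrite in_ker_groundP //; split=> [g_psi|]; last exact: in_G_ground.
  apply: ground_in_G g_psi _ => //; first lia.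
  by apply: word_coef_size; apply/eqP => /=; lia.
- rewrite in_ker_groundP //; set k7 := ket C 7 w1100011.
  have g_ket : ground lam (word_coef k7) by apply: ground_ket_1100011.
  split=> [g_psi|[phi [c [G_phi ->]]]].
    pose c := word_coef psi w1100011.
    exists (psi - vscale c k7), c; rewrite subrK; split=> //.
    apply: ground_in_G => //.
      apply: eq_ground (ground_lin (- c) g_ket g_psi) => s.
      by rewrite word_coefB word_coefZ mulNr addrC.
    by rewrite word_coefB word_coefZ word_coef_ket // /ket_word eqxx mulr1 subrr.
  apply: eq_ground (ground_lin c g_ket (in_G_ground G_phi)) => s.
  by rewrite word_coefD word_coefZ addrC.
- have := in_G_1100011 G_ket.
  by rewrite word_coefZ word_coef_ket // /ket_word eqxx mulr1.
Qed.
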